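(* Let $m\ge 2$, let $n_1,\dots,n_m$ be positive integers, and let $D(K_{n_1,n_2,\cdots,n_m})$ be the distance matrix of the complete $m$-partite graph $K_{n_1,n_2,\cdots,n_m}$ on $|V|=\sum_{i=1}^m n_i$ vertices. Then $$\operatorname{cof} D(K_{n_1,n_2,\cdots,n_m}) = (-2)^{|V|-m}\left[ \sum_{i=1}^m \left( n_i\prod_{j \neq i}(n_j - 2) \right)\right].$$
   Context: $K_{n_1,\dots,n_m}$ is the graph whose vertex set is partitioned into $V_1,\dots,V_m$ with $|V_i|=n_i$, two vertices being adjacent if and only if they lie in different parts. The distance matrix $D(G)$ of a connected graph $G$ has $(u,v)$ entry $d(u,v)$, the length of a shortest path between $u$ and $v$. For a square matrix $B$ of order $n$, $\operatorname{cof} B$ denotes the sum of all cofactors of $B$, i.e. $\operatorname{cof} B=\mathds{1}^t\,\mathrm{Adj}(B)\,\mathds{1}$, where $\mathds{1}$ is the all-ones column vector and $\mathrm{Adj}(B)$ is the adjugate matrix. *)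

(* Defs.v *)
From mathcomp Require Import all_boot all_order all_algebra.

Set Implicit Arguments.
Unset Strict Implicit.
Unset Printing Implicit Defensive.

Import GRing.Theory.
Local Open Scope ring_scope.

(* A graph is given by its adjacency relation on a finite type of vertices.   *)
(* [walk e k u v] is the existence of u = x_0, x_1, ..., x_k = v with         *)
(* consecutive vertices adjacent.                                             *)
Definition walk (T : finType) (e : rel T) (k : nat) (u v : T) : bool :=
  [exists p : k.-tuple T, path e u p && (last u p == v)].

(* A shortest path has fewer than #|T| edges, so searching k < #|T| suffices. *)
(* When v is not reachable from u the value is the junk value #|T|.           *)
Definition gdist (T : finType) (e : rel T) (u v : T) : nat :=
  find (fun k => walk e k u v) (iota 0 #|T|).

Lemma walkP (T : finType) (e : rel T) k u v :
  reflect (exists p : seq T, [/\ size p = k, path e u p & last u p = v])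
          (walk e k u v).
Proof.
apply: (iffP existsP) => [[p /andP[ep /eqP lp]]|[p [sp ep lp]]].
  by exists p; rewrite size_tuple.
by move/eqP: sp => sp; exists (Tuple sp); rewrite /= ep lp eqxx.
Qed.

Lemma gdist_le (T : finType) (e : rel T) (u : T) (p : seq T) :
  path e u p -> (gdist e u (last u p) <= size p)%N.
Proof.
move=> ep; rewrite leqNgt; apply/negP => lt_p.
have lt_pT : (size p < #|T|)%N.
  by apply: leq_trans lt_p _; rewrite -[leqRHS](size_iota 0) find_size.
have := before_find 0%N lt_p; rewrite nth_iota // add0n //= => /negbT/negP; apply.
by apply/walkP; exists p.
Qed.

Lemma gdist_path (T : finType) (e : rel T) (u v : T) :
  connect e u v ->
  exists p : seq T, [/\ size p = gdist e u v, path e u p & last u p = v].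
Proof.
move=> /connectP[q eq ->]; case/shortenP: eq => p ep Up _.
have lt_p : (size p < #|T|)%N.
  by have := max_card (mem (u :: p)); rewrite (card_uniqP Up).
have hs : has (fun k => walk e k u (last u p)) (iota 0 #|T|).
  by apply/hasP; exists (size p); rewrite ?mem_iota //; apply/walkP; exists p.
have := nth_find 0%N hs; rewrite nth_iota ?add0n; first by move=> /= /walkP.
by rewrite -[ltnRHS](size_iota 0) -has_find.
Qed.

(* Matrices are indexed by ordinals; vertices are listed in the order         *)
(* [enum T] (the sum of all cofactors does not depend on this order).         *)
Definition dist_mx (T : finType) (e : rel T) : 'M[int]_#|T| :=
  \matrix_(i, j) (gdist e (enum_val i) (enum_val j))%:Z.

Definition cof (R : comNzRingType) (n : nat) (B : 'M[R]_n) : R :=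
  \sum_(i < n) \sum_(j < n) cofactor B i j.

Lemma cofE (R : comNzRingType) (n : nat) (B : 'M[R]_n) :
  (const_mx 1 : 'rV_n) *m \adj B *m (const_mx 1 : 'cV_n) = (cof B)%:M.
Proof.
apply/matrixP => i j; rewrite !ord1 !mxE mulr1n; apply: eq_bigr => k _.
by rewrite !mxE mulr1; apply: eq_bigr => l _; rewrite !mxE mul1r.
Qed.

Section CompleteMultipartite.
Variables (m : nat) (n : 'I_m -> nat).

(* The vertex (i, a), with a < n i, is the a-th vertex of the i-th part.      *)
Definition Kmulti_vertex : finType := {i : 'I_m & 'I_(n i)}.

Definition Kmulti : rel Kmulti_vertex := [rel u v | tag u != tag v].

Lemma card_Kmulti_vertex : #|Kmulti_vertex| = (\sum_(i < m) n i)%N.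
Proof.
by rewrite card_tagged sumnE big_map big_enum;
  apply: eq_bigr => i _; rewrite card_ord.
Qed.

Lemma Kmulti_connected (u v : Kmulti_vertex) :
  (2 <= m)%N -> (forall i, (0 < n i)%N) -> connect Kmulti u v.
Proof.
move=> hm hn; have [uv|uv] := eqVneq (tag u) (tag v); last exact: connect1.
have [i iu] : exists i, i != tag u.
  apply/existsP; apply: contraLR hm => /existsPn iu; rewrite -leqNgt.
  rewrite -(card_ord m) -(card1 (tag u)); apply/subset_leq_card/subsetP => i _.
  by rewrite inE; apply/negPn/iu.
pose w : Kmulti_vertex := Tagged (fun i => 'I_(n i)) (Ordinal (hn i)).
apply: (@connect_trans _ _ w); apply: connect1; rewrite /Kmulti /=.
  by rewrite eq_sym.
by rewrite -uv.
Qed.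

End CompleteMultipartite.

Arguments Kmulti {m} n.

(* Main.v *)
Require Import Defs.
From mathcomp Require Import all_boot all_order all_algebra.
From mathcomp Require Import fingroup perm.

(** Let N be the number of vertices, J an all-ones matrix and P the N x m matrix
whose (u, i) entry is 1 when the vertex u lies in the part i, and 0 otherwise.
Two distinct vertices are at distance 2 in the same part and at distance 1 in
different parts, so the distance matrix is

  D = -2 I + J + P P^T = -2 I + P (I + J) P^T,

where the second form uses P J P^T = J ([dist_mx_Kmulti]).

The map x |-> det (D + x J) is affine with slope cof D, because J has rank one
([det_add_rank1], [cof_det]); hence cof D = det (D + J) - det D. Both of these
determinants have the form det (-2 I + P (I + x J) P^T), with x = 2 and x = 1.
The identity c^m det (c I + A B) = c^N det (c I + B A) ([det_add_scalarC])
exchanges the factors and shrinks the problem from size N to size m: as P^T P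
is the diagonal matrix of the part sizes ([part_mx_gram]), what remains is

  det (diag (n_i - 2) + x 1 (n_1, ..., n_m))
    = prod_i (n_i - 2) + x sum_i n_i prod_(j <> i) (n_j - 2)

([det_diag_add_rank1]). Subtracting the values at x = 1 from those at x = 2
leaves the sum, and (-2)^m can be cancelled since m <= N. *)

Import GRing.Theory.
Local Open Scope ring_scope.

(** Sylvester's exchange identity. Multiplying the block matrix with rows (c, A)
and (-B, 1) by a triangular one on the right isolates c + A B, and on the left
c + B A. The powers of c stay on both sides so that c need not be a unit. *)
Lemma det_add_scalarC (R : comNzRingType) (N m : nat) (c : R)
    (A : 'M[R]_(N, m)) (B : 'M[R]_(m, N)) :
  c ^+ m * \det (c%:M + A *m B) = c ^+ N * \det (c%:M + B *m A).
Proof.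
pose M := block_mx c%:M A (- B) (1%:M : 'M[R]_m).
have <- : \det M = \det (c%:M + A *m B).
  have := det_mulmx M (block_mx 1%:M 0 B 1%:M).
  rewrite mulmx_block !mulmx1 !mulmx0 !mul1mx !add0r addNr.
  by rewrite det_lblock det_ublock !det1 !mulr1 => <-.
have := det_mulmx (block_mx (1%:M : 'M[R]_N) 0 B c%:M) M.
rewrite mulmx_block !mul1mx !mul0mx !addr0 mulmx1 mulmxN.
rewrite -(scalar_mxC c) subrr det_ublock.
by rewrite det_lblock !det_scalar !expr1n mul1r [B *m A + _]addrC.
Qed.

(** Both sides are read off the bordered matrix with rows (1, -v) and (u, A).
Clearing the row -v gives det (A + u v); clearing the column u by means of the
adjugate gives the right-hand side, but only up to a factor det A, which
regularity cancels. *)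
Lemma det_add_rank1_reg (R : comNzRingType) (n : nat)
    (A : 'M[R]_n) (u : 'cV[R]_n) (v : 'rV[R]_n) :
  GRing.rreg (\det A) ->
  \det (A + u *m v) = \det A + (v *m \adj A *m u) 0 0.
Proof.
move=> regA; apply: regA.
pose M := block_mx (1%:M : 'M[R]_1) (- v) u A.
have <- : \det M = \det (A + u *m v).
  have := det_mulmx M (block_mx 1%:M v 0 1%:M).
  rewrite mulmx_block !mulmx1 !mulmx0 !mul1mx !addr0 addrN.
  by rewrite det_lblock det_ublock !det1 !mulr1 mul1r addrC.
have := det_mulmx M (block_mx (\det A)%:M 0 (- (\adj A *m u)) 1%:M).
rewrite mulmx_block !mulmx1 !mulmx0 !mul1mx !add0r.
rewrite mulmxN mulNmx opprK mulmxN !mulmxA mul_mx_adj.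
rewrite -(scalar_mxC (\det A)) subrr det_lblock det_scalar1 det1 mulr1 => <-.
by rewrite det_ublock det_mx11 !mxE eqxx mulr1n.
Qed.

(** The regularity assumption is removed by a generic perturbation: the
determinant of A + X I is a monic polynomial, hence regular, and the identity
over polynomials specialises at X = 0 to the one for A. *)
Lemma det_add_rank1 (R : comNzRingType) (n : nat)
    (A : 'M[R]_n) (u : 'cV[R]_n) (v : 'rV[R]_n) :
  \det (A + u *m v) = \det A + (v *m \adj A *m u) 0 0.
Proof.
pose ev : {poly R} -> R := horner_eval 0.
have evC k l (B : 'M[R]_(k, l)) : map_mx ev (map_mx polyC B) = B.
  by apply/matrixP => i j; rewrite !mxE /ev /horner_eval hornerC.
have evA : map_mx ev (char_poly_mx (- A)) = A.
  apply/matrixP => i j; rewrite !mxE /ev /horner_eval.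
  by rewrite hornerD hornerMn hornerX mul0rn hornerN hornerC opprK add0r.
have reg := monic_rreg (char_poly_monic (- A)).
have := congr1 ev (det_add_rank1_reg _ _ _ (map_mx polyC u) (map_mx polyC v) reg).
(* The single entry is written as a trace, which commutes with map_mx. *)
have -> : (map_mx polyC v *m \adj (char_poly_mx (- A)) *m map_mx polyC u) 0 0
   = \tr (map_mx polyC v *m \adj (char_poly_mx (- A)) *m map_mx polyC u).
  by rewrite trace_mx11.
rewrite /ev rmorphD /= -!det_map_mx -trace_map_mx map_mxD !map_mxM /= map_mx_adj.
by rewrite -/ev !evC evA trace_mx11.
Qed.

Lemma cof_det (R : comNzRingType) (n : nat) (B : 'M[R]_n) :
  cof B = \det (B + const_mx 1) - \det B.
Proof.
have -> : const_mx 1 = (const_mx 1 : 'cV[R]_n) *m (const_mx 1 : 'rV[R]_n).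
  by apply/matrixP => i j; rewrite !mxE big_ord1 !mxE mulr1.
by rewrite det_add_rank1 cofE mxE eqxx mulr1n addrC addKr.
Qed.

(** In the Leibniz expansion of the cofactor (i, j), a permutation contributes
only if it fixes every index other than i, and then it is the identity. This
needs no invertibility, so it covers vanishing diagonal entries, which occur
below for parts of size 2. *)
Lemma adj_diag (R : comNzRingType) (n : nat) (d : 'rV[R]_n) :
  \adj (diag_mx d) = diag_mx (\row_i \prod_(j < n | j != i) d 0 j).
Proof.
apply/matrixP => i j; rewrite !mxE expand_cofactor.
have vanish (s : 'S_n) k : j != k -> s k != k ->
    \prod_(l | j != l) diag_mx d l (s l) = 0.
  move=> jk sk; rewrite (bigD1 k) //= mxE.
  by rewrite [k == _]eq_sym (negbTE sk) mulr0n mul0r.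
have [->|ij] := eqVneq i j; last first.
  rewrite mulr0n big1 // => s /eqP sj.
  rewrite (vanish s i) ?mulr0 //; first by rewrite eq_sym.
  by rewrite -{2}sj (inj_eq perm_inj).
rewrite mulr1n (bigD1 1%g) ?perm1 //= [X in _ + X]big1 ?addr0.
  rewrite odd_perm1 mul1r; apply: eq_big => [k|k _]; first by rewrite eq_sym.
  by rewrite perm1 mxE eqxx.
move=> s /andP[/eqP sj s1].
have [k sk] : exists k, s k != k.
  apply/existsP; apply: contraR s1 => /existsPn fix_s.
  by apply/eqP/permP => k; rewrite perm1; apply/eqP/negPn/fix_s.
rewrite (vanish s k) ?mulr0 //.
by apply: contraNneq sk => <-; rewrite sj.
Qed.

Lemma det_diag_add_rank1 (R : comNzRingType) (n : nat)
    (d v : 'rV[R]_n) (u : 'cV[R]_n) :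
  \det (diag_mx d + u *m v) =
    \prod_i d 0 i + \sum_i v 0 i * u i 0 * \prod_(j < n | j != i) d 0 j.
Proof.
rewrite det_add_rank1 det_diag adj_diag mul_mx_diag mxE; congr (_ + _).
by apply: eq_bigr => i _; rewrite !mxE mulrAC.
Qed.

Section DistanceMatrix.
Variables (m : nat) (n : 'I_m -> nat).
Hypotheses (hm : (2 <= m)%N) (hn : forall i, (0 < n i)%N).

(** Two vertices of the same part are not adjacent, but they have a common
neighbour in any other part, and another part exists because m >= 2. *)
Lemma gdist_Kmulti (u v : Kmulti_vertex n) :
  gdist (Kmulti n) u v = if u == v then 0%N else if tag u == tag v then 2 else 1.
Proof.
case: ifPn => [/eqP <-|uv].
  by apply/eqP; rewrite -leqn0; apply: (@gdist_le _ (Kmulti n) u [::]).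
have [p [sp ep lp]] := gdist_path (Kmulti_connected u v hm hn).
case: ifPn => [tuv|tuv].
  have [i iu] : exists i, i != tag u.
    apply/existsP; apply: contraLR hm => /existsPn iu; rewrite -leqNgt.
    rewrite -(card_ord m) -(card1 (tag u)).
    apply/subset_leq_card/subsetP => i _.
    by rewrite inE; apply/negPn/iu.
  pose w : Kmulti_vertex n := Tagged (fun i => 'I_(n i)) (Ordinal (hn i)).
  have le2 : (gdist (Kmulti n) u v <= 2)%N.
    by apply: (@gdist_le _ (Kmulti n) u [:: w; v]);
      rewrite /= /Kmulti /= -(eqP tuv) iu eq_sym iu.
  apply/eqP; rewrite eqn_leq le2 -sp.
  case: p ep lp {sp} => [|x [|y p]] //= => [_ e|]; first by rewrite e eqxx in uv.
  by rewrite andbT => ux e; rewrite /Kmulti /= e tuv in ux.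
have le1 : (gdist (Kmulti n) u v <= 1)%N.
  by apply: (@gdist_le _ (Kmulti n) u [:: v]); rewrite /= /Kmulti /= tuv.
apply/eqP; rewrite eqn_leq le1 -sp.
by case: p ep lp {sp} => [|x p] //= _ e; rewrite e eqxx in uv.
Qed.

Definition part_of (i : 'I_#|Kmulti_vertex n|) : 'I_m := tag (enum_val i).

Definition part_mx : 'M[int]_(#|Kmulti_vertex n|, m) := rowsub part_of 1%:M.

(** Conjugation by the incidence matrix replicates the entry (i, j) of Q on the
block of pairs of vertices in the parts i and j. In particular it sends J to J. *)
Lemma part_mx_conj (Q : 'M[int]_m) :
  part_mx *m Q *m part_mx^T = mxsub part_of part_of Q.
Proof.
rewrite /part_mx mul_rowsub_mx mul1mx trmx_mxsub trmx1 mulmx_colsub mulmx1.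
by apply/matrixP => i j; rewrite !mxE.
Qed.

Lemma part_mx_gram : part_mx^T *m part_mx = diag_mx (\row_i (n i)%:Z).
Proof.
apply/matrixP => i j; rewrite !mxE.
pose F (u : Kmulti_vertex n) : int := (tag u == i)%:R * (tag u == j)%:R.
transitivity (\sum_(u in Kmulti_vertex n) F u).
  by rewrite [RHS]big_enum_val; apply: eq_bigr => k _; rewrite !mxE.
transitivity (\sum_k \sum_(a : 'I_(n k)) ((k == i)%:R * (k == j)%:R : int)).
  by rewrite (sig_big_dep _ _ (fun k _ => (k == i)%:R * (k == j)%:R : int)).
rewrite (bigD1 i) //= [X in _ + X]big1 ?addr0 => [|k /negbTE ki].
  rewrite sumr_const card_ord eqxx mul1r.
  by case: (i == j); rewrite ?mulr1n ?mulr0n ?mul0rn -?natz.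
by rewrite big1 // => a _; rewrite ki mul0r.
Qed.

Lemma dist_mx_Kmulti :
  dist_mx (Kmulti n) =
    (-2)%:M + part_mx *m ((1%:M + const_mx 1) *m part_mx^T).
Proof.
rewrite mulmxA part_mx_conj; apply/matrixP => i j.
rewrite !mxE gdist_Kmulti (inj_eq enum_val_inj) /part_of.
by have [->|] := eqVneq i j; rewrite ?eqxx //; case: (tag _ == _).
Qed.

(** The matrix on the left is D + (x - 1) J. Keeping x free serves both
determinants of which the cofactor sum is the difference. *)
Lemma det_shifted_dist (x : int) :
  (-2) ^+ m *
    \det ((-2)%:M + part_mx *m ((1%:M + const_mx x) *m part_mx^T)) =
  (-2) ^+ #|Kmulti_vertex n| *
    (\prod_(i < m) ((n i)%:Z - 2) +
     x * \sum_(i < m) ((n i)%:Z * \prod_(j < m | j != i) ((n j)%:Z - 2))).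
Proof.
rewrite det_add_scalarC -mulmxA part_mx_gram; congr (_ * _).
have -> : (-2)%:M + (1%:M + const_mx x) *m diag_mx (\row_i (n i)%:Z) =
    diag_mx (\row_i ((n i)%:Z - 2)) + const_mx x *m (\row_i (n i)%:Z).
  apply/matrixP => i j; rewrite mul_mx_diag !mxE big_ord1 !mxE mulrDl addrA.
  congr (_ + _); have [->|_] := eqVneq i j; last by rewrite !mulr0n mul0r addr0.
  by rewrite !mulr1n mul1r addrC.
rewrite det_diag_add_rank1; congr (_ + _).
  by apply: eq_bigr => i _; rewrite mxE.
rewrite mulr_sumr; apply: eq_bigr => i _; rewrite !mxE mulrA [x * _]mulrC.
by congr (_ * _); apply: eq_bigr => j _; rewrite mxE.
Qed.

End DistanceMatrix.

Theorem theorem2p2 (m : nat) (n : 'I_m -> nat)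
    (hm : (2 <= m)%N) (hn : forall i : 'I_m, (0 < n i)%N) :
  cof (dist_mx (Kmulti n)) =
    (-2) ^+ (#|Kmulti_vertex n| - m) *
    \sum_(i < m) ((n i)%:Z * \prod_(j < m | j != i) ((n j)%:Z - 2)).
Proof.
have le_m : (m <= #|Kmulti_vertex n|)%N.
  rewrite card_Kmulti_vertex -[leqLHS]card_ord -sum1_card.
  by apply: leq_sum => i _; apply: hn.
have nz : (-2 : int) ^+ m != 0 by rewrite expf_neq0.
apply: (mulfI nz); rewrite mulrA -exprD subnKC // cof_det mulrBr.
have -> : dist_mx (Kmulti n) + const_mx 1 =
    (-2)%:M + part_mx m n *m ((1%:M + const_mx 2) *m (part_mx m n)^T).
  rewrite dist_mx_Kmulti // -addrA; congr (_ + _); rewrite !mulmxA !part_mx_conj.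
  by apply/matrixP => i j; rewrite !mxE -addrA.
rewrite dist_mx_Kmulti // !det_shifted_dist -mulrBr; congr (_ * _).
by rewrite mul1r [X in X - _]addrC addrKA mulr_natl mulr2n addrK.
Qed.
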